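(* Let $m\ge1$, and let $G$ be the full-support binary context presentation of order $m$ with parameters $(p_u)_{u\in\{0,1\}^m}$, $p_u\in(0,1)$: its state set is $\mathcal S_m=\{0,1\}^m$, its update is $\delta(u,x)=u_2\cdots u_mx$ for $u=u_1\cdots u_m$ and $x\in\{0,1\}$ (meaning $\delta(u,x)=x$ when $m=1$), and its emissions are $e_u(1)=p_u$, $e_u(0)=1-p_u$. If the $2^m$ numbers $p_u$ are pairwise distinct, then $G$ (with its stationary distribution) is an exact finite-state generator $\epsilon$-machine and $$|\mathcal S_m|=2^m,\qquad L_{\mathrm{tar}}(G)=m,\qquad L_{\mathrm{sep}}(G)=1.$$ Its synchronization order $L_{\mathrm{syn}}(G)$ and the Markov order of the process it generates are also $m$, and the process Hankel matrix has full rank $2^m$.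
   Context: Words. $\mathcal X$ is a nonempty finite alphabet (here $\{0,1\}$), $\mathcal X^m$ the words of length $m$, $\mathcal X^*$ all finite words, $\lambda$ the empty word; $X_i^j=(X_i,\dots,X_j)$. Generator. A finite-state generator $\epsilon$-machine over $\mathcal X$ is $G=(\mathcal S,\pi,\delta,\{e_\sigma\}_{\sigma\in\mathcal S})$ where: (1) $\mathcal S$ is a nonempty finite set of states and each $e_\sigma$ is a probability mass function on $\mathcal X$; (2) a pair $(\sigma,x)$ is admissible when $e_\sigma(x)>0$, and a successor $\delta(\sigma,x)\in\mathcal S$ is defined exactly on admissible pairs; (3) the directed graph of positive-probability labeled transitions $\sigma\to\delta(\sigma,x)$ is strongly connected; (4) for $\sigma\neq\tau$ there is a word $w\in\mathcal X^*$ with $p_\sigma(w)\neq p_\tau(w)$, where $p_\sigma(w)=P(X_1^{|w|}=w\mid S_0=\sigma)$ (so $p_\sigma(\lambda)=1$); (5) $\pi$ is the unique probability vector with $\pi T=\pi$, where $T_{\sigma\tau}=\sum_{x:\,e_\sigma(x)>0,\ \delta(\sigma,x)=\tau}e_\sigma(x)$. The dynamics are $P(X_{t+1}=x,S_{t+1}=\delta(\sigma,x)\mid S_t=\sigma)=e_\sigma(x)$ for admissible $(\sigma,x)$, and the process generated by $G$ is the observable process $(X_t)_{t\in\mathbb Z}$ of the stationary joint law with $S_0\sim\pi$. Synchronization. A positive-probability word $w\in\mathcal X^k$, $k\ge0$, synchronizes to $\sigma$ if $P(S_k=\sigma\mid X_1^k=w)=1$ (conditioning on $\lambda$ is trivial).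 It synchronizes if it synchronizes to some state. $G$ is exact if it has a finite positive-probability synchronizing word. Radii. $L_{\mathrm{tar}}(G)=\max_{\sigma\in\mathcal S}\inf\{|w|: w\text{ synchronizes to }\sigma\}$ and $L_{\mathrm{sep}}(G)=\max_{\sigma\neq\tau}\min\{|v|:p_\sigma(v)\neq p_\tau(v)\}$ (both $0$ for a one-state generator). The synchronization order is $L_{\mathrm{syn}}(G)=\inf\{k:\text{every positive-probability word in }\mathcal X^k\text{ synchronizes}\}$. Here $\inf\emptyset=\infty$. Markov order. The Markov order of a stationary process is the least $k\ge0$ such that the conditional law of the next symbol given the entire past depends only on the last $k$ symbols, almost surely ($\infty$ if none exists). Hankel matrix. The process Hankel matrix of $P$ is the infinite matrix $H_{u,v}=P(uv)$, $u,v\in\mathcal X^*$, where $P(w)=P(X_1^{|w|}=w)$ and $P(\lambda)=1$. *)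

(* Defs.v *)
From HB Require Import structures.
From mathcomp Require Import all_boot all_order all_algebra.
From mathcomp Require Import all_classical all_reals all_analysis.

Set Implicit Arguments.
Unset Strict Implicit.
Unset Printing Implicit Defensive.

Import Order.TTheory GRing.Theory Num.Theory.

Local Open Scope classical_set_scope.
Local Open Scope ring_scope.

Section Generator.
Variables (R : realType) (X S : finType).

(* [succ s x = None] when no successor is defined. *)
Record generator := Generator {
  emit : S -> X -> R;
  succ : S -> X -> option S;
  stat : S -> R }.

Definition is_pmf (I : finType) (q : I -> R) : Prop :=
  (forall i, 0 <= q i) /\ \sum_i q i = 1.

Variable G : generator.

(* P(X_{t+1} = x, S_{t+1} = s' | S_t = s). *)
Definition trans (s : S) (x : X) (s' : S) : R :=
  if succ G s x == Some s' then emit G s x else 0.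

Definition transition_matrix (s s' : S) : R := \sum_x trans s x s'.

Definition edge : rel S :=
  fun s s' => [exists x, (0 < emit G s x) && (succ G s x == Some s')].

(* P(X_1^{|w|} = w, S_{|w|} = s' | S_0 = s). *)
Fixpoint path_prob (s : S) (w : seq X) (s' : S) : R :=
  if w is x :: w' then \sum_r trans s x r * path_prob r w' s'
  else (s == s')%:R.

(* p_s(w) = P(X_1^{|w|} = w | S_0 = s). *)
Definition state_word_prob (s : S) (w : seq X) : R :=
  \sum_s' path_prob s w s'.

(* P(X_1^{|w|} = w, S_{|w|} = s) with S_0 distributed as [stat G]. *)
Definition word_state_prob (w : seq X) (s : S) : R :=
  \sum_r stat G r * path_prob r w s.

(* P(w) = P(X_1^{|w|} = w). *)
Definition word_prob (w : seq X) : R :=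
  \sum_s stat G s * state_word_prob s w.

Definition stationary (q : S -> R) : Prop :=
  is_pmf q /\ forall s', \sum_s q s * transition_matrix s s' = q s'.

Definition is_epsilon_machine : Prop :=
  [/\ (0 < #|S|)%N /\ (forall s, is_pmf (emit G s)),
      forall s x, (succ G s x != None) = (0 < emit G s x),
      forall s s', connect edge s s',
      forall s s', s != s' ->
        exists w, state_word_prob s w <> state_word_prob s' w &
      stationary (stat G) /\ (forall q, stationary q -> q = stat G)].

Definition synchronizes_to (w : seq X) (s : S) : Prop :=
  0 < word_prob w /\ word_state_prob w s / word_prob w = 1.

Definition synchronizes (w : seq X) : Prop := exists s, synchronizes_to w s.

Definition exact_generator : Prop := exists w, synchronizes w.

End Generator.

(* Infimum of a set of naturals in the extended reals, +oo on the empty set. *)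
Definition nat_inf (R : realType) (A : set nat) : \bar R :=
  ereal_inf [set n%:R%:E | n in A].

Section Radii.
Variables (R : realType) (X S : finType) (G : generator R X S).

Definition L_tar : \bar R :=
  \big[maxe/0%E]_(s : S) nat_inf R [set size w | w in synchronizes_to G ^~ s].

Definition L_sep : \bar R :=
  \big[maxe/0%E]_(st : S * S | st.1 != st.2)
    nat_inf R [set size v | v in
      [set v | state_word_prob G st.1 v <> state_word_prob G st.2 v]].

Definition L_syn : \bar R :=
  nat_inf R [set k | forall w : k.-tuple X, 0 < word_prob G w ->
                       synchronizes G w].

Definition hankel (u v : seq X) : R := word_prob G (u ++ v).

End Radii.

(* Rank of a matrix with arbitrary index sets: the supremum of the ranks of its
   finite submatrices. *)
Definition infinite_rank (R : realType) (I J : Type) (H : I -> J -> R)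
    : \bar R :=
  ereal_sup [set z | exists (k l : nat) (u : 'I_k -> I) (v : 'I_l -> J),
    z = (\rank (\matrix_(i < k, j < l) H (u i) (v j)))%:R%:E].

(* [f] is a version of the conditional probability of the event [E] given the
   sigma-algebra [F]. *)
Definition is_cond_prob (R : realType) (d : measure_display)
    (T : measurableType d) (P : probability T R) (F : set (set T)) (E : set T)
    (f : T -> R) : Prop :=
  [/\ forall B : set R, measurable B -> F (f @^-1` B),
      P.-integrable setT (EFin \o f) &
      forall A, F A -> (\int[P]_(t in A) (f t)%:E = P (A `&` E))%E].

Section Process.
Variables (R : realType) (X : finType) (d : measure_display)
  (T : measurableType d) (P : probability T R) (x_ : int -> T -> X).

Definition past : set (set T) :=
  <<s [set A | exists (t : int) (x : X), t <= 0 /\ A = x_ t @^-1` [set x]] >>.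

(* (X_{-k+1}, ..., X_0). *)
Definition last_symbols (k : nat) (o : T) : k.-tuple X :=
  [tuple x_ (i%:Z - k%:Z + 1) o | i < k].

(* For a stationary process it suffices to look at the next symbol X_1 at
   time 0. *)
Definition next_depends_on_last (k : nat) : Prop :=
  exists (f : X -> T -> R) (g : k.-tuple X -> X -> R), forall x,
    is_cond_prob P past (x_ 1 @^-1` [set x]) (f x) /\
    {ae P, forall o, f x o = g (last_symbols k o) x}.

Definition markov_order : \bar R := nat_inf R next_depends_on_last.

(* (X_t, S_t), with t ranging over the integers, has the stationary joint law
   of G; S_t is the state after X_t has been emitted. *)
Definition has_joint_law (S : finType) (G : generator R X S)
    (s_ : int -> T -> S) : Prop :=
  [/\ forall t x, measurable (x_ t @^-1` [set x]),
      forall t s, measurable (s_ t @^-1` [set s]) &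
      forall (t : int) (n : nat) (x : nat -> X) (s : nat -> S),
        P [set o | (forall i, (i <= n)%N -> s_ (t + i%:Z) o = s i) /\
                   (forall i, (i < n)%N -> x_ (t + i.+1%:Z) o = x i)]
        = (stat G (s 0%N) *
           \prod_(0 <= i < n) trans G (s i) (x i) (s i.+1))%:E].

Definition generated_by (S : finType) (G : generator R X S) : Prop :=
  exists s_ : int -> T -> S, has_joint_law G s_.

End Process.

(* The letters 0 and 1 are [false] and [true]; every transition is admissible
   when all parameters lie in (0, 1). *)
Definition binary_context (R : realType) (m : nat) (p : m.-tuple bool -> R)
    (q : m.-tuple bool -> R) : generator R bool (m.-tuple bool) :=
  {| emit := fun u x => if x then p u else 1 - p u;
     succ := fun u x => Some [tuple of behead (rcons u x)];
     stat := q |}.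

(* Main.v *)
(* Reading m letters puts the context presentation into the state equal to the
   word just read, whatever the initial state. Hence the m-step transition
   kernel is strictly positive, so the stationary law exists, is unique and has
   full support; words of length m synchronize, while a word of length k < m
   leaves the first m - k letters of the state undetermined.
   For the rank, P(uv) = P(u) p_u(v) for |u| = m, and the functions
   v |-> p_u(v), |v| = m, are linearly independent: a vanishing combination is
   the row vector c T_{v_1} ... T_{v_m} = 0 for all v, and letters are peeled
   off from the right because (T_0, T_1) is jointly injective on row vectors.
   For the Markov order, a pi-lambda argument over the events determined by
   finitely many past letters shows that the emission probability of the state
   read off the last m letters is the conditional law of the next letter; two
   states with the same last k < m letters have different emissions, which
   excludes shorter memory. *)

Require Import Defs.
From HB Require Import structures.
From mathcomp Require Import all_boot all_order all_algebra.
From mathcomp Require Import all_classical all_reals all_analysis.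
From mathcomp Require Import measurable_realfun ring zify.

Set Implicit Arguments.
Unset Strict Implicit.
Unset Printing Implicit Defensive.

Import Order.TTheory GRing.Theory Num.Theory.

Local Open Scope ring_scope.

(** * Perron-Frobenius theory for a primitive stochastic kernel *)

Section PrimitiveStochastic.
Variables (R : realType) (S : finType) (T : S -> S -> R).

Definition fixed_by (v : S -> R) : Prop :=
  forall s', \sum_s v s * T s s' = v s'.

(** Matrix power of [T], unfolded at the first step so that its recursion runs parallel to that of
    [path_prob]. *)
Fixpoint iter_kernel (k : nat) (s s' : S) : R :=
  if k is k'.+1 then \sum_r T s r * iter_kernel k' r s' else (s == s')%:R.

Lemma sum_delta (s : S) (F : S -> R) : \sum_r (s == r)%:R * F r = F s.
Proof.
rewrite (bigD1 s) //= eqxx mul1r big1 ?addr0 // => r rs.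
by rewrite eq_sym (negbTE rs) mul0r.
Qed.

Lemma fixed_by_iter (v : S -> R) (k : nat) (s' : S) :
  fixed_by v -> \sum_s v s * iter_kernel k s s' = v s'.
Proof.
move=> fv; elim: k => [|k IH] /=.
  under eq_bigr do rewrite mulrC eq_sym.
  exact: sum_delta.
under eq_bigr do rewrite mulr_sumr.
rewrite exchange_big /= -[RHS]IH; apply: eq_bigr => r _.
by under eq_bigr do rewrite mulrA; rewrite -mulr_suml fv.
Qed.

Hypothesis T1 : forall s, \sum_s' T s s' = 1.

Lemma iter_kernel_row_sum (k : nat) (s : S) : \sum_s' iter_kernel k s s' = 1.
Proof.
elim: k s => [|k IH] s /=.
  by under eq_bigr do rewrite -[_%:R]mulr1; rewrite (sum_delta s (fun=> 1)).
rewrite exchange_big /= -[RHS](T1 s); apply: eq_bigr => r _.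
by rewrite -mulr_sumr IH mulr1.
Qed.

Lemma sum_enum_val (F : S -> R) :
  \sum_(i < #|S|) F (enum_val i) = \sum_s F s.
Proof.
rewrite [RHS](reindex (@enum_val S S)) //=.
by exists enum_rank => x _; rewrite ?enum_valK ?enum_rankK.
Qed.

(** Row sums 1 put the constant vector, nonzero thanks to [s0], in the right kernel of [T - 1]; a
    singular square matrix has a left kernel too. *)
Lemma exists_fixed_by (s0 : S) :
  exists2 v : S -> R, fixed_by v & exists s, v s != 0.
Proof.
pose A := \matrix_(i < #|S|, j < #|S|) T (enum_val i) (enum_val j) - 1%:M.
have : \det A == 0.
  rewrite -det_tr; apply/det0P; exists (const_mx 1).
    apply/eqP => /rowP /(_ (enum_rank s0)) /eqP.
    by rewrite !mxE oner_eq0.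
  apply/rowP => i; rewrite !mxE.
  under eq_bigr do rewrite !mxE mul1r.
  rewrite sumrB (sum_enum_val (T (enum_val i))) T1.
  rewrite (bigD1 i) //= eqxx big1 ?addr0 ?subrr // => j ji.
  by rewrite eq_sym (negbTE ji).
case/det0P => v v0 vA; exists (fun s => v 0 (enum_rank s)).
  move=> s'; have /rowP /(_ (enum_rank s')) := vA.
  rewrite !mxE => /eqP; under eq_bigr do rewrite !mxE mulrBr.
  rewrite sumrB subr_eq0 => /eqP E.
  rewrite -sum_enum_val.
  transitivity (\sum_i v 0 i * T (enum_val i) (enum_val (enum_rank s'))).
    by apply: eq_bigr => i _; rewrite enum_valK enum_rankK.
  rewrite E (bigD1 (enum_rank s')) //= eqxx mulr1 big1 ?addr0 // => j ji.
  by rewrite (negbTE ji) mulr0.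
have [/forallP h|] := boolP [forall s, v 0 (enum_rank s) == 0].
  case/eqP: v0; apply/rowP => i; rewrite mxE -(enum_valK i); exact/eqP/h.
by rewrite negb_forall => /existsP [s sP]; exists s.
Qed.

Variable k : nat.
Hypothesis T_primitive : forall s s', 0 < iter_kernel k s s'.

(* Equality in the triangle inequality for the strictly positive k-th power. *)
Lemma fixed_by_sign (s0 : S) (v : S -> R) : fixed_by v ->
  (forall s, `|v s| = v s) \/ (forall s, `|v s| = - v s).
Proof.
move=> fv.
have le s' : `|v s'| <= \sum_s `|v s| * iter_kernel k s s'.
  rewrite -{1}(fixed_by_iter k s' fv); apply: le_trans (ler_norm_sum _ _ _) _.
  by apply: ler_sum => s _; rewrite normrM (gtr0_norm (T_primitive s s')).
(* The gaps in [le] are nonnegative and, as the power has row sums 1, add up to 0 over [s']; hence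
   each of them is 0. *)
have E : `|v s0| = \sum_s `|v s| * iter_kernel k s s0.
  apply/eqP; rewrite eq_sym -subr_eq0; apply/eqP.
  have ge0 s' : true -> 0 <= \sum_s `|v s| * iter_kernel k s s' - `|v s'|.
    by rewrite subr_ge0.
  apply: (psumr_eq0P ge0) => //.
  rewrite sumrB exchange_big /= -sumrB big1 // => s _.
  by rewrite -mulr_sumr iter_kernel_row_sum mulr1 subrr.
(* The sign of [v s0] enters as a factor [c], so that both cases share one argument. *)
have key (c : R) : `|v s0| = c * v s0 -> (forall s, c * v s <= `|v s|) ->
    forall s, `|v s| = c * v s.
  move=> h lec s.
  have ge0 r : true -> 0 <= (`|v r| - c * v r) * iter_kernel k r s0.
    by rewrite mulr_ge0 ?subr_ge0 // ltW.
  have : \sum_r (`|v r| - c * v r) * iter_kernel k r s0 = 0.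
    under eq_bigr do rewrite mulrBl -mulrA.
    by rewrite sumrB -E h -mulr_sumr fixed_by_iter // subrr.
  move/(psumr_eq0P ge0) => /(_ s isT) /eqP.
  by rewrite mulf_eq0 (gt_eqF (T_primitive s s0)) orbF subr_eq0 => /eqP.
have [v0|v0] := lerP 0 (v s0).
  left => s; rewrite -[RHS]mul1r; apply: key => [|r]; rewrite mul1r.
    exact: ger0_norm.
  exact: ler_norm.
right => s; rewrite -[RHS]mulN1r; apply: key => [|r]; rewrite mulN1r.
  exact: ltr0_norm.
by rewrite -normrN ler_norm.
Qed.

(** The entries share one sign, so nothing cancels in the sum. For a nonzero fixed vector this
    permits normalisation; for a difference it gives uniqueness. *)
Lemma fixed_by_sum0 (s0 : S) (v : S -> R) :
  fixed_by v -> \sum_s v s = 0 -> forall s, v s = 0.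
Proof.
move=> fv v0 s; case: (fixed_by_sign s0 fv) => h.
  have ge0 r : true -> 0 <= v r by rewrite -h.
  exact: (psumr_eq0P ge0).
have ge0 r : true -> 0 <= - v r by rewrite -h.
apply/eqP; rewrite -oppr_eq0; apply/eqP; apply: (psumr_eq0P ge0) => //.
by rewrite sumrN v0 oppr0.
Qed.

Lemma primitive_stationary (s0 : S) : exists q : S -> R,
  [/\ forall s, 0 < q s, \sum_s q s = 1, fixed_by q &
      forall q', \sum_s q' s = 1 -> fixed_by q' -> q' = q].
Proof.
have [v fv [s1 v1]] := exists_fixed_by s0.
have c0 : \sum_s v s != 0.
  by apply: contra_neq v1 => /(fixed_by_sum0 s0 fv).
pose q s := v s / \sum_s v s.
have q1 : \sum_s q s = 1 by rewrite -mulr_suml divff.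
have fq : fixed_by q.
  by move=> s'; under eq_bigr do rewrite mulrAC; rewrite -mulr_suml fv.
exists q; split => //.
  have q_ge0 s : 0 <= q s.
    case: (fixed_by_sign s0 fq) => h; first by rewrite -h.
    have : 0 <= \sum_s - q s by apply: sumr_ge0 => r _; rewrite -h.
    by rewrite sumrN q1 leNgt oppr_lt0 ltr01.
  (* A zero entry [q s] would be a positively weighted sum of all entries of [q], forcing [q] to
     vanish. *)
  move=> s; rewrite lt_def q_ge0 andbT; apply/eqP => qs0.
  have ge0 r : true -> 0 <= q r * iter_kernel k r s.
    by rewrite mulr_ge0 // ltW.
  have /(psumr_eq0P ge0) h : \sum_r q r * iter_kernel k r s = 0.
    by rewrite fixed_by_iter.
  have : \sum_s q s = 0.
    apply: big1 => r _; have /eqP := h r isT.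
    by rewrite mulf_eq0 (gt_eqF (T_primitive r s)) orbF => /eqP.
  by rewrite q1 => /eqP; rewrite oner_eq0.
move=> q' q'1 fq'; apply/funext => s; apply/eqP; rewrite -subr_eq0; apply/eqP.
apply: (@fixed_by_sum0 s0 (fun s => q' s - q s)).
  by move=> s'; under eq_bigr do rewrite mulrBl; rewrite sumrB fq' fq.
by rewrite sumrB q1 q'1 subrr.
Qed.

End PrimitiveStochastic.

(** * Word probabilities of a general generator *)

Section WordProbabilities.
Variables (R : realType) (X S : finType) (G : generator R X S).

Lemma state_word_prob_nil s : state_word_prob G s [::] = 1.
Proof.
rewrite /state_word_prob /=; under eq_bigr do rewrite -[_%:R]mulr1.
exact: sum_delta (fun=> 1).
Qed.

Lemma state_word_prob_cons s x w :
  state_word_prob G s (x :: w) = \sum_r trans G s x r * state_word_prob G r w.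
Proof.
rewrite /state_word_prob /= exchange_big /=.
by apply: eq_bigr => r _; rewrite mulr_sumr.
Qed.

Lemma state_word_prob_cat s u v : state_word_prob G s (u ++ v) =
  \sum_r path_prob G s u r * state_word_prob G r v.
Proof.
elim: u s => [|x u IH] s /=; first by rewrite sum_delta.
rewrite state_word_prob_cons; under [RHS]eq_bigr do rewrite mulr_suml.
rewrite exchange_big /=; apply: eq_bigr => r _.
by rewrite IH mulr_sumr; apply: eq_bigr => r' _; rewrite mulrA.
Qed.

(** Split at the state reached after [u]; read as a matrix identity, this factors the Hankel matrix
    through the state set. *)
Lemma word_prob_cat u v : word_prob G (u ++ v) =
  \sum_s word_state_prob G u s * state_word_prob G s v.
Proof.
rewrite /word_prob; under [RHS]eq_bigr do rewrite mulr_suml.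
rewrite exchange_big /=; apply: eq_bigr => r _.
by rewrite state_word_prob_cat mulr_sumr; apply: eq_bigr => s _; rewrite mulrA.
Qed.

Lemma word_prob_sum_state w : word_prob G w = \sum_s word_state_prob G w s.
Proof.
rewrite -[w in LHS]cats0 word_prob_cat.
by apply: eq_bigr => s _; rewrite state_word_prob_nil mulr1.
Qed.

(** The paths labelled [w] are among all paths of length [size w]. A labelled path of positive
    probability thus yields a positive entry of the power. *)
Lemma path_prob_le_iter (emit_ge0 : forall s x, 0 <= emit G s x) w s s' :
  path_prob G s w s' <= iter_kernel (transition_matrix G) (size w) s s'.
Proof.
have trans_ge0 r x r' : 0 <= trans G r x r' by rewrite /trans; case: ifP.
elim: w s => //= x w IH s; apply: ler_sum => r _.
rewrite /transition_matrix mulr_suml (bigD1 x) //=.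
apply: ler_wpDr; last exact: ler_wpM2l.
apply: sumr_ge0 => y _; apply: mulr_ge0 => //.
elim: (size w) r {IH} => [|k IH] r /=; first by rewrite ler0n.
by apply: sumr_ge0 => t _; apply: mulr_ge0 => //; apply: sumr_ge0.
Qed.

Lemma transition_matrix_row_sum s :
  (forall x, succ G s x != None) -> \sum_x emit G s x = 1 ->
  \sum_s' transition_matrix G s s' = 1.
Proof.
move=> adm e1; rewrite /transition_matrix exchange_big /= -[RHS]e1.
apply: eq_bigr => x _; rewrite /trans.
case: (succ G s x) (adm x) => // r _; rewrite (bigD1 r) //= eqxx.
rewrite big1 ?addr0 // => r' /negbTE rr'.
by rewrite (inj_eq Some_inj) eq_sym rr'.
Qed.

End WordProbabilities.

(** * The context presentation as a shift register *)

Section BinaryContext.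
Variables (R : realType) (m : nat) (p q : m.-tuple bool -> R).
Hypothesis m_gt0 : (0 < m)%N.
Hypothesis p01 : forall u, 0 < p u < 1.

Local Notation G := (binary_context p q).

Definition context_succ (u : m.-tuple bool) (x : bool) : m.-tuple bool :=
  [tuple of behead (rcons u x)].

Definition run (u : m.-tuple bool) (w : seq bool) : m.-tuple bool :=
  foldl context_succ u w.

(** Each letter enters on the right and pushes one out on the left. *)
Lemma run_drop u w : run u w = drop (size w) (u ++ w) :> seq bool.
Proof.
elim: w u => [|x w IH] u; first by rewrite /= cats0 drop0.
rewrite [LHS]IH /= -[X in drop (size w).+1 X]cat_rcons.
(* A nonempty context is what makes [behead] remove a letter, matching the one counted by [drop]. *)
have : (0 < size u)%N by rewrite size_tuple.
by case: (tval u).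
Qed.

Lemma run_tuple u (w : m.-tuple bool) : run u w = w.
Proof. by apply: val_inj; rewrite /= run_drop drop_size_cat // !size_tuple. Qed.

Lemma run_long u u' w : (m <= size w)%N -> run u w = run u' w.
Proof.
move=> mw; apply: val_inj.
by rewrite /= !run_drop !drop_cat !size_tuple ltnNge mw.
Qed.

Lemma emit_gt0 u x : 0 < emit G u x.
Proof. by case/andP: (p01 u) => p0 p1; case: x; rewrite //= subr_gt0. Qed.

Lemma sum_trans u x (F : m.-tuple bool -> R) :
  \sum_r trans G u x r * F r = emit G u x * F (context_succ u x).
Proof.
rewrite (bigD1 (context_succ u x)) //= /trans /= eqxx big1 ?addr0 // => r.
by rewrite (inj_eq Some_inj) eq_sym => /negbTE ->; rewrite mul0r.
Qed.

Lemma state_word_prob_context_cons u x w :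
  state_word_prob G u (x :: w) =
  emit G u x * state_word_prob G (context_succ u x) w.
Proof. by rewrite state_word_prob_cons sum_trans. Qed.

Lemma state_word_prob_letter u x : state_word_prob G u [:: x] = emit G u x.
Proof. by rewrite state_word_prob_context_cons state_word_prob_nil mulr1. Qed.

Lemma state_word_prob_gt0 u w : 0 < state_word_prob G u w.
Proof.
elim: w u => [|x w IH] u; first by rewrite state_word_prob_nil.
by rewrite state_word_prob_context_cons mulr_gt0 // emit_gt0.
Qed.

(** The letters determine the path from [u], so the sum over paths has a single nonzero term. *)
Lemma path_prob_run u w s :
  path_prob G u w s = (run u w == s)%:R * state_word_prob G u w.
Proof.
elim: w u => [|x w IH] u; first by rewrite state_word_prob_nil mulr1.
by rewrite /= sum_trans IH state_word_prob_context_cons mulrCA.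
Qed.

(** After [m] letters the register has forgotten its initial state, so the indicator, computed from
    an arbitrary [u], comes out of the sum. *)
Lemma word_state_prob_long u w s : (m <= size w)%N ->
  word_state_prob G w s = (run u w == s)%:R * word_prob G w.
Proof.
move=> mw; rewrite /word_prob mulr_sumr; apply: eq_bigr => r _.
by rewrite path_prob_run (run_long r u mw) mulrCA.
Qed.

Lemma word_prob_cat_long u w v : (m <= size w)%N ->
  word_prob G (w ++ v) = word_prob G w * state_word_prob G (run u w) v.
Proof.
move=> mw; rewrite word_prob_cat.
under eq_bigr do rewrite (word_state_prob_long u _ mw) -mulrA.
by rewrite sum_delta.
Qed.

(** The target [v], read as a word, labels a path of length [m] from [u] to [v] with positive
    emissions. *)
Lemma binary_context_primitive u v :
  0 < iter_kernel (transition_matrix G) m u v.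
Proof.
have emit_ge0 s x : 0 <= emit G s x by exact/ltW/emit_gt0.
have := path_prob_le_iter emit_ge0 v u v; rewrite {1}size_tuple.
apply: lt_le_trans.
by rewrite path_prob_run run_tuple eqxx mul1r state_word_prob_gt0.
Qed.

Lemma emit_sum1 u : \sum_x emit G u x = 1.
Proof. by rewrite big_bool /= addrCA subrr addr0. Qed.

Lemma connect_run u w : connect (edge G) u (run u w).
Proof.
elim: w u => [|x w IH] u; first exact: connect0.
apply: connect_trans (IH (context_succ u x)); apply: connect1.
by apply/existsP; exists x; rewrite emit_gt0 /=.
Qed.

End BinaryContext.

(* Reading a further letter x acts on row vectors by
   (c T_x)(b x) = c(0b) e_{0b}(x) + c(1b) e_{1b}(x), so that c T_0 and c T_1
   together determine c(0b) and c(1b) as soon as p(0b) and p(1b) differ. *)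
Lemma trans_injective (R : realType) (m : nat) (p q c : m.-tuple bool -> R) :
  (0 < m)%N -> injective p ->
  (forall x s, \sum_u c u * trans (binary_context p q) u x s = 0) ->
  forall u, c u = 0.
Proof.
case: m p q c => // n p q c _ p_inj h u; case/tupleP: u => a b.
pose t y : n.+1.-tuple bool := [tuple of y :: b].
have E x : c (t true) * emit (binary_context p q) (t true) x +
           c (t false) * emit (binary_context p q) (t false) x = 0.
  rewrite -[RHS](h x [tuple of rcons b x]).
  rewrite (bigD1 (t true)) //= (bigD1 (t false)) //=.
  rewrite big1 ?addr0 => [|u].
    have tr y : trans (binary_context p q) (t y) x [tuple of rcons b x] =
        emit (binary_context p q) (t y) x.
      by rewrite /trans ifT //; apply/eqP/(congr1 Some)/val_inj.
    by rewrite !tr.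
  case/tupleP: u => y u /andP[y1 y0].
  rewrite /trans /= ifF ?mulr0 //; apply/eqP => -[] /rcons_inj [ub].
  have {ub} ub : u = b by apply: val_inj.
  by case: y y1 y0 => y1 y0; [case/negP: y1|case/negP: y0];
    rewrite ub; apply/eqP/val_inj.
have p10 : p (t true) != p (t false) by apply/eqP => /p_inj /(congr1 val).
have [E1 E0] := (E true, E false); rewrite /= in E1 E0.
have F : c (t true) + c (t false) = 0.
  by rewrite -[RHS](addr0 0) -{1}E1 -E0; ring.
have Ct : c (t true) * (p (t true) - p (t false)) = 0.
  by rewrite -E1 -[RHS]subr0 -(mul0r (p (t false))) -F; ring.
have ct : c (t true) = 0.
  by apply/eqP; move/eqP: Ct; rewrite mulf_eq0 subr_eq0 (negbTE p10) orbF.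
have cf : c (t false) = 0 by rewrite -F ct add0r.
by rewrite -[LHS]/(c (t a)); case: a.
Qed.

(** * Rank of the Hankel matrix *)

Section HankelRank.
Variables (R : realType) (m : nat) (p q : m.-tuple bool -> R).
Hypothesis m_gt0 : (0 < m)%N.
Hypothesis p01 : forall u, 0 < p u < 1.
Hypothesis p_inj : injective p.
Hypothesis q_gt0 : forall u, 0 < q u.

Local Notation G := (binary_context p q).

Lemma word_prob_gt0 w : 0 < word_prob G w.
Proof.
rewrite /word_prob (bigD1 [tuple of nseq m true]) //=.
apply: ltr_wpDr; last by rewrite mulr_gt0 // state_word_prob_gt0.
by apply: sumr_ge0 => u _; rewrite mulr_ge0 // ltW // state_word_prob_gt0.
Qed.

(** The induction hypothesis, applied to the row vector $c T_x$, gives $c T_x = 0$ for both letters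
    [x]; then [trans_injective] concludes. *)
Lemma path_prob_injective k (c : m.-tuple bool -> R) :
  (forall w s, size w = k -> \sum_u c u * path_prob G u w s = 0) ->
  forall u, c u = 0.
Proof.
elim: k c => [|k IH] c h u.
  rewrite -[RHS](h [::] u erefl) /= -(sum_delta u c).
  by apply: eq_bigr => v _; rewrite mulrC eq_sym.
apply: (trans_injective (q := q) m_gt0 p_inj) => x.
apply: IH => w s wk; rewrite -[RHS](h (x :: w) s) /= ?wk //.
under [RHS]eq_bigr do rewrite mulr_sumr.
rewrite [RHS]exchange_big /=; apply: eq_bigr => r _.
by rewrite mulr_suml; apply: eq_bigr => v _; rewrite mulrA.
Qed.

(** A word of length [m] determines the final state, so summing over final states loses no
    information. *)
Lemma state_word_prob_injective (c : m.-tuple bool -> R) :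
  (forall w : m.-tuple bool, \sum_u c u * state_word_prob G u w = 0) ->
  forall u, c u = 0.
Proof.
move=> h; apply: (path_prob_injective (k := m)) => w s /eqP wm.
have hr v : run v w = Tuple wm by exact: (run_tuple m_gt0 v (Tuple wm)).
have [e|ne] := eqVneq (Tuple wm) s.
  rewrite -[RHS](h (Tuple wm)); apply: eq_bigr => v _.
  by rewrite path_prob_run hr -e eqxx mul1r.
by apply: big1 => v _; rewrite path_prob_run hr (negbTE ne) mul0r mulr0.
Qed.

Lemma rank_hankel_le k l (u : 'I_k -> seq bool) (v : 'I_l -> seq bool) :
  (\rank (\matrix_(i < k, j < l) hankel G (u i) (v j)) <= 2 ^ m)%N.
Proof.
set H := \matrix_(_, _) _.
pose A := \matrix_(i < k, a < #|{: m.-tuple bool}|)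
  word_state_prob G (u i) (enum_val a).
pose B := \matrix_(a < #|{: m.-tuple bool}|, j < l)
  state_word_prob G (enum_val a) (v j).
have -> : H = A *m B.
  apply/matrixP => i j; rewrite !mxE /hankel word_prob_cat -sum_enum_val.
  by apply: eq_bigr => a _; rewrite !mxE.
apply: leq_trans (mxrankM_maxl _ _) _.
by apply: leq_trans (rank_leq_col _) _; rewrite card_tuple card_bool.
Qed.

(** Row [u] of this block is $P(u)$ times the function $p_u$ on words of length [m]; independence of
    these functions survives scaling by positive numbers. *)
Lemma hankel_words_free :
  row_free (\matrix_(i < #|{: m.-tuple bool}|, j < #|{: m.-tuple bool}|)
    hankel G (enum_val i) (enum_val j)).
Proof.
apply/row_freeP; set H := \matrix_(_, _) _.
suff : kermx H = 0.
  by move/eqP; rewrite kermx_eq0 => /row_freeP.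
apply/row_matrixP => i; rewrite row0.
have := mulmx_ker H; move/row_matrixP/(_ i); rewrite row0 row_mul.
move: (row i (kermx H)) => {i} c cH.
pose d (u : m.-tuple bool) := c 0 (enum_rank u) * word_prob G u.
have d0 : forall u, d u = 0.
  apply: state_word_prob_injective => w.
  have /rowP /(_ (enum_rank w)) := cH; rewrite !mxE; apply: etrans.
  rewrite -sum_enum_val; apply: eq_bigr => a _; rewrite !mxE enum_rankK.
  rewrite /d enum_valK -mulrA /hankel.
  have mu : (m <= size (enum_val a))%N by rewrite size_tuple.
  by rewrite (word_prob_cat_long p q m_gt0 w _ mu) run_tuple.
apply/rowP => a; rewrite mxE; apply/eqP; have /eqP := d0 (enum_val a).
by rewrite /d enum_valK mulf_eq0 (gt_eqF (word_prob_gt0 _)) orbF.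
Qed.

Lemma hankel_rank : infinite_rank (hankel G) = (2 ^ m)%:R%:E.
Proof.
apply/eqP; rewrite eq_le; apply/andP; split.
  apply: ge_ereal_sup => _ [k [l [u [v ->]]]].
  by rewrite lee_fin ler_nat rank_hankel_le.
apply: ereal_sup_ubound; exists #|{: m.-tuple bool}|, #|{: m.-tuple bool}|.
exists (fun i => tval (enum_val i)), (fun i => tval (enum_val i)).
by rewrite (eqP hankel_words_free) card_tuple card_bool.
Qed.

End HankelRank.

(** * Infima and maxima in the extended reals *)

Section ExtendedExtrema.
Variable R : realType.

Lemma nat_inf_min (A : set nat) k :
  A k -> (forall n, A n -> (k <= n)%N) -> nat_inf R A = k%:R%:E.
Proof.
move=> Ak lek; apply/eqP; rewrite eq_le; apply/andP; split.
  by apply: ereal_inf_lbound; exists k.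
by apply: le_ereal_inf_tmp => _ [n An <-]; rewrite lee_fin ler_nat lek.
Qed.

(** The index [i0] excludes an empty maximum, whose value would be the default 0; [0 <= c] keeps
    this default from exceeding [c]. *)
Lemma bigmaxe_const (I : finType) (P : pred I) (F : I -> \bar R) (c : \bar R)
    (i0 : I) : P i0 -> (0 <= c)%E -> (forall i, P i -> F i = c) ->
  \big[maxe/0%E]_(i | P i) F i = c.
Proof.
move=> Pi0 c0 Fc; rewrite (eq_bigr (fun=> c)) //.
rewrite (bigD1 i0) //=; apply/max_idPl.
by elim/big_ind: _ => // x y; rewrite ge_max => -> ->.
Qed.

End ExtendedExtrema.

(** * Synchronization, the radii and the epsilon-machine conditions *)

Section Synchronization.
Variables (R : realType) (m : nat) (p q : m.-tuple bool -> R).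
Hypothesis m_gt0 : (0 < m)%N.
Hypothesis p01 : forall u, 0 < p u < 1.
Hypothesis q_gt0 : forall u, 0 < q u.

Local Notation G := (binary_context p q).

Lemma synchronizes_long u w :
  (m <= size w)%N -> synchronizes_to G w (run u w).
Proof.
move=> mw; split; first exact: word_prob_gt0.
rewrite (word_state_prob_long p q m_gt0 u _ mw) eqxx mul1r divff //.
by rewrite gt_eqF // word_prob_gt0.
Qed.

(** With fewer than [m] letters read, the leftmost letter of the state still comes from the initial
    state. *)
Lemma run_short_neq w : (size w < m)%N ->
  run [tuple of nseq m true] w != run [tuple of nseq m false] w.
Proof.
move=> wm; apply/eqP => /(congr1 val); rewrite /= !run_drop //=.
have E b : drop (size w) (nseq m b ++ w) = nseq (m - size w) b ++ w.
  by rewrite drop_cat size_nseq wm drop_nseq.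
rewrite !E; move: wm; rewrite -subn_gt0.
by case: (m - size w)%N.
Qed.

Lemma word_state_prob_run_gt0 u w : 0 < word_state_prob G w (run u w).
Proof.
rewrite /word_state_prob (bigD1 u) //=.
apply: ltr_wpDr; last first.
  by rewrite path_prob_run eqxx mul1r mulr_gt0 // state_word_prob_gt0.
apply: sumr_ge0 => v _; rewrite path_prob_run mulr_ge0 ?(ltW (q_gt0 v)) //.
by rewrite mulr_ge0 ?ler0n // ltW // state_word_prob_gt0.
Qed.

(** Conditional probability 1 leaves no mass outside [s], whereas each [run u w] carries positive
    mass; so [run u w] cannot vary with [u]. *)
Lemma synchronizes_size w : synchronizes G w -> (m <= size w)%N.
Proof.
case=> s [w_gt0 /divr1_eq ws]; rewrite leqNgt; apply/negP => wm.
have ge0 r : r != s -> 0 <= word_state_prob G w r.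
  move=> _; apply: sumr_ge0 => v _; rewrite path_prob_run.
  rewrite mulr_ge0 ?(ltW (q_gt0 v)) //.
  by rewrite mulr_ge0 ?ler0n // ltW // state_word_prob_gt0.
have : \sum_(r | r != s) word_state_prob G w r = 0.
  have := word_prob_sum_state G w; rewrite (bigD1 s) //= ws.
  by rewrite -[LHS]addr0 => /addrI /esym.
move/(psumr_eq0P ge0) => h.
have eq_s u : run u w = s.
  apply/eqP; apply: contraT => /h /eqP.
  by rewrite (gt_eqF (word_state_prob_run_gt0 _ _)).
by have := run_short_neq wm; rewrite !eq_s eqxx.
Qed.

Lemma binary_context_L_tar : L_tar G = m%:R%:E.
Proof.
apply: (bigmaxe_const (i0 := [tuple of nseq m true])) => // s _.
apply: nat_inf_min => [|_ [w ws <-]]; last first.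
  by apply: synchronizes_size; exists s.
(* The word [s] synchronizes to the state [s]. *)
exists s; last exact: size_tuple.
rewrite -{2}(run_tuple m_gt0 s s); apply: synchronizes_long.
by rewrite size_tuple.
Qed.

Lemma binary_context_L_syn : L_syn G = m%:R%:E.
Proof.
apply: nat_inf_min => [w _|k h].
  by exists (run w w); apply: synchronizes_long; rewrite size_tuple.
(* Every word has positive probability, so any word of length [k] can be fed to [h]. *)
have w_gt0 := word_prob_gt0 p01 q_gt0 [tuple of nseq k true].
have := synchronizes_size (h _ w_gt0).
by rewrite size_tuple.
Qed.

Lemma binary_context_L_sep : injective p -> L_sep G = 1%:E.
Proof.
move=> p_inj.
pose uv0 := ([tuple of nseq m true], [tuple of nseq m false]).
apply: (bigmaxe_const (i0 := uv0)).
(* On the empty word [run] is the identity, so this says that the two constant contexts differ. *)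
- by have := @run_short_neq [::] m_gt0.
- by rewrite lee_fin.
move=> [u v] /= /eqP uv; apply: (@nat_inf_min R _ 1%N).
  by exists [:: true] => //=; rewrite !state_word_prob_letter => /p_inj.
by move=> _ [[|x w] /= + <-] //; rewrite !state_word_prob_nil.
Qed.

Lemma binary_context_is_epsilon_machine :
  injective p -> \sum_u q u = 1 -> fixed_by (transition_matrix G) q ->
  (forall q', \sum_u q' u = 1 -> fixed_by (transition_matrix G) q' -> q' = q) ->
  is_epsilon_machine G.
Proof.
move=> p_inj q1 fq uq; split.
- split; first by apply/card_gt0P; exists [tuple of nseq m true].
  by move=> u; split=> [x|]; [exact/ltW/emit_gt0 | exact: emit_sum1].
- by move=> u x; rewrite emit_gt0.
- by move=> u v; rewrite -(run_tuple m_gt0 u v) connect_run.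
- move=> u v /eqP uv; exists [:: true].
  by rewrite !state_word_prob_letter => /p_inj.
- split; last by move=> q' [[_ q'1] fq']; exact: uq.
  by split=> //; split=> // u; exact: ltW.
Qed.

End Synchronization.

(** * Splitting integrals along a finite-valued variable *)

Section FinitePartition.
Local Open Scope classical_set_scope.
Variables (R : realType) (d : measure_display) (T : measurableType d).
Variables (I : finType) (Z : T -> I).
Hypothesis mZ : forall i, measurable (Z @^-1` [set i]).

Lemma integral_partition (mu : {measure set T -> \bar R}) (A : set T)
    (f : T -> \bar R) : measurable A -> measurable_fun A f ->
  (forall o, (0 <= f o)%E) ->
  (\int[mu]_(o in A) f o =
   \sum_i \int[mu]_(o in A `&` Z @^-1` [set i]) f o)%E.
Proof.
move=> mA mf f0.
have AE : A = \big[setU/set0]_(i <- index_enum I) (A `&` Z @^-1` [set i]).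
  rewrite -bigcup_seq; apply/seteqP; split=> [ o Ao|o [i _ []]] //.
  by exists (Z o) => //=; exact: mem_index_enum.
rewrite {1}AE ge0_integral_bigsetU //.
- by move=> i; exact: measurableI.
- exact: index_enum_uniq.
- by move=> i j _ _ [ o [[_ <-] [_ <-]]].
- by rewrite -AE.
Qed.

Lemma measure_partition (mu : {measure set T -> \bar R}) (A : set T) :
  measurable A -> (mu A = \sum_i mu (A `&` Z @^-1` [set i]))%E.
Proof.
move=> mA; rewrite -[LHS]mul1e -integral_cst // integral_partition //.
apply: eq_bigr => i _; rewrite integral_cst ?mul1e //; exact: measurableI.
Qed.

End FinitePartition.

(** * From the joint law to word probabilities *)

Section ReadingWords.
Local Open Scope classical_set_scope.
Variables (R : realType) (X S : finType) (G : generator R X S).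
Variables (d : measure_display) (T : measurableType d) (P : probability T R).
Variables (x_ : int -> T -> X) (s_ : int -> T -> S).
Hypothesis law : has_joint_law P x_ G s_.

(** Here [t] is the time of the state that emits the word, so the first letter sits at time
    [t + 1]. *)
Definition symbols_after (t : int) (n : nat) (o : T) : seq X :=
  mkseq (fun i => x_ (t + i.+1%:Z) o) n.

Definition history (t : int) (n : nat) (x : nat -> X) (s : nat -> S) : set T :=
  [set o | (forall i, (i <= n)%N -> s_ (t + i%:Z) o = s i) /\
           (forall i, (i < n)%N -> x_ (t + i.+1%:Z) o = x i)].

Lemma measurable_symbols_after t n (B : set (seq X)) :
  measurable (symbols_after t n @^-1` B).
Proof.
case: law => mx _ _; elim: n B => [|n IH] B.
  have [B0|B0] := pselect (B [::]).
    by rewrite (_ : _ @^-1` _ = setT) //; apply/seteqP; split.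
  by rewrite (_ : _ @^-1` _ = set0) //; apply/seteqP; split.
(* Fixing the last letter [y] replaces [B] by the words that [y] completes to a member of [B]. *)
rewrite (_ : _ @^-1` _ = \bigcup_(y in [set: X])
    (symbols_after t n @^-1` [set w | B (rcons w y)] `&`
     x_ (t + n.+1%:Z) @^-1` [set y])).
  apply: fin_bigcup_measurable => [|y _]; first exact: finite_finset.
  by apply: measurableI.
apply/seteqP; split=> o; rewrite /symbols_after /= mkseqS.
  by move=> Bo; exists (x_ (t + n.+1%:Z) o).
by move=> [y _ [Bo yo]]; rewrite [x_ _ _]yo.
Qed.

Lemma measurable_history t n x s : measurable (history t n x s).
Proof.
case: law => mx ms _.
rewrite (_ : history t n x s =
  \bigcap_(i in `I_n.+1) s_ (t + i%:Z) @^-1` [set s i] `&`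
  \bigcap_(i in `I_n) x_ (t + i.+1%:Z) @^-1` [set x i]) //.
by apply: measurableI; apply: fin_bigcap_measurable.
Qed.

(** The history is arbitrary so that the induction on [w] can move its first letter, with the state
    that follows, into the history; for empty [w] the joint law applies. *)
Lemma history_word_prob t n x s w :
  P (history t n x s `&` symbols_after (t + n%:Z) (size w) @^-1` [set w]) =
  (stat G (s 0%N) * \prod_(0 <= i < n) trans G (s i) (x i) (s i.+1) *
   state_word_prob G (s n) w)%:E.
Proof.
case: (law) => mx ms plaw; elim: w n x s => [|y w IH] n x s.
  rewrite state_word_prob_nil mulr1 -(plaw t); congr (P _).
  by apply/seteqP; split=> o //= [].
pose x' (i : nat) := if i == n then y else x i.
pose s' r (i : nat) := if i == n.+1 then r else s i.
have mA : measurable (history t n x s `&`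
    symbols_after (t + n%:Z) (size (y :: w)) @^-1` [set y :: w]).
  apply: measurableI; first exact: measurable_history.
  exact: measurable_symbols_after.
rewrite (measure_partition (ms (t + n.+1%:Z)) P mA).
rewrite state_word_prob_cons mulr_sumr -sumEFin; apply: eq_bigr => r _.
have s'n i : (i <= n)%N -> s' r i = s i.
  by rewrite /s'; case: eqP => // -> ; rewrite ltnn.
have x'n i : (i < n)%N -> x' i = x i.
  by rewrite /x'; case: eqP => // ->; rewrite ltnn.
transitivity (P (history t n.+1 x' (s' r) `&`
    symbols_after (t + n.+1%:Z) (size w) @^-1` [set w])).
  congr (P _).
  have tn : t + n%:Z + 1 = t + n.+1%:Z by lia.
  have E o : (symbols_after (t + n%:Z) (size w).+1 o = y :: w) <->
      (x_ (t + n.+1%:Z) o = y /\ symbols_after (t + n.+1%:Z) (size w) o = w).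
    rewrite /symbols_after /mkseq /= tn (iotaDl 1 0) -map_comp.
    rewrite (@eq_map _ _ _ (fun i => x_ (t + n.+1%:Z + i.+1%:Z) o)); last first.
      by move=> i /=; congr (x_ _ o); lia.
    by split=> [[-> ->]|[-> ->]].
  apply/seteqP; split=> o /=.
    move=> [[[hs hx] /E [hy hw]] hr]; split=> //; split=> i.
      rewrite leq_eqVlt => /orP[/eqP ->|i_n]; first by rewrite /s' eqxx.
      by rewrite s'n // hs.
    rewrite ltnS leq_eqVlt => /orP[/eqP ->|i_n]; first by rewrite /x' eqxx.
    by rewrite x'n // hx.
  move=> [[hs hx] hw]; split; last by rewrite hs // /s' eqxx.
  split; last by apply/E; rewrite hx // /x' eqxx.
  split=> i i_n; first by rewrite hs ?s'n // ltnW.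
  by rewrite hx ?x'n // ltnW.
rewrite IH big_nat_recr //=; congr (_%:E).
have s'S : s' r n.+1 = r by rewrite /s' eqxx.
have x'S : x' n = y by rewrite /x' eqxx.
rewrite s'S x'S (s'n 0%N) // (s'n n) // !mulrA; congr (_ * _ * _ * _).
by apply: eq_big_nat => i i_n; rewrite x'n // !s'n // ltnW.
Qed.

Lemma symbols_after_prob (x0 : X) t w :
  P (symbols_after t (size w) @^-1` [set w]) = (word_prob G w)%:E.
Proof.
case: (law) => _ ms _.
rewrite (measure_partition (ms t) P (measurable_symbols_after _ _ _)).
rewrite /word_prob -sumEFin; apply: eq_bigr => r _.
(* A history of length 0 records just the state at time [t]. *)
have := history_word_prob t 0 (fun=> x0) (fun=> r) w.
rewrite big_nil mulr1 addr0 => <-; congr (P _).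
apply/seteqP; split=> o /=.
  move=> [ow sr]; split=> //; split=> // i.
  by rewrite leqn0 => /eqP ->; rewrite addr0.
by move=> [[/(_ 0%N isT) + _] ow]; rewrite addr0.
Qed.

End ReadingWords.

(** * The Markov order of the generated process *)

Section MarkovOrder.
Local Open Scope classical_set_scope.
Variables (R : realType) (m : nat) (p q : m.-tuple bool -> R).
Hypothesis m_gt0 : (0 < m)%N.
Hypothesis p01 : forall u, 0 < p u < 1.
Hypothesis q_gt0 : forall u, 0 < q u.
Local Notation G := (binary_context p q).
Variables (d : measure_display) (T : measurableType d) (P : probability T R).
Variables (x_ : int -> T -> bool) (s_ : int -> T -> m.-tuple bool).
Hypothesis law : has_joint_law P x_ G s_.

(** The letters at times $-n+1$ to 0, as a sequence rather than a tuple, so that windows of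
    different lengths can be compared. *)
Local Notation window n := (symbols_after x_ (- n%:Z) n).

Lemma tval_last_symbols k o : last_symbols x_ k o = window k o :> seq bool.
Proof.
apply: (@eq_from_nth _ true); rewrite size_tuple ?size_mkseq // => i ik.
rewrite -(tnth_nth _ _ (Ordinal ik)) tnth_mktuple nth_mkseq //=.
by congr (x_ _ o); lia.
Qed.

Lemma drop_window k n o : (k <= n)%N -> drop (n - k) (window n o) = window k o.
Proof.
move=> kn; apply: (@eq_from_nth _ true).
  by rewrite size_drop !size_mkseq subKn.
rewrite size_drop !size_mkseq subKn // => i ik.
rewrite nth_drop !nth_mkseq //; last by lia.
by congr (x_ _ o); lia.
Qed.

(** This ties observed letters to contexts without recourse to the hidden states [s_]. *)
Lemma last_symbols_run u n o : (m <= n)%N ->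
  last_symbols x_ m o = run u (window n o).
Proof.
move=> mn; apply: val_inj; rewrite [RHS]run_drop // [LHS]tval_last_symbols.
by rewrite drop_cat size_tuple size_mkseq ltnNge mn /= drop_window.
Qed.

Lemma measurable_last_symbols k (B : set (k.-tuple bool)) :
  measurable (last_symbols x_ k @^-1` B).
Proof.
rewrite (_ : _ @^-1` _ = window k @^-1` [set w | exists2 u, B u & w = tval u]).
  exact: measurable_symbols_after law _ _ _.
apply/seteqP; split=> o /=; rewrite -tval_last_symbols.
  by move=> Bo; exists (last_symbols x_ k o).
by move=> [u Bu /val_inj ->].
Qed.

Lemma past_measurable : past x_ `<=` measurable.
Proof.
apply: smallest_sub; first exact: sigma_algebra_measurable.
by move=> _ [t [x [_ ->]]]; case: law => mx _ _; exact: mx.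
Qed.

Lemma past_last_symbols k (B : set (k.-tuple bool)) :
  past x_ (last_symbols x_ k @^-1` B).
Proof.
pose gen := [set A | exists (t : int) (x : bool),
  t <= 0 /\ A = x_ t @^-1` [set x]].
(* The sigma-algebra of the past becomes a measurable space of its own, so that closure under finite
   unions and intersections applies to it. *)
pose GT : measurableType gen.-sigma := g_sigma_algebraType gen.
rewrite (_ : _ @^-1` _ = \bigcup_(u in B) \bigcap_(i in [set: 'I_k])
    x_ (i%:Z - k%:Z + 1) @^-1` [set tnth u i]).
  apply: (@fin_bigcup_measurable _ GT) => [|u _]; first exact: finite_finset.
  apply: (@fin_bigcap_measurable _ GT) => [|i _]; first exact: finite_finset.
  apply: sub_sigma_algebra; exists (i%:Z - k%:Z + 1), (tnth u i).
  by split=> //; have := ltn_ord i; lia.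
apply/seteqP; split=> o /=.
  by move=> Bo; exists (last_symbols x_ k o) => //= i _; rewrite tnth_mktuple.
move=> [u Bu uo]; rewrite (_ : last_symbols x_ k o = u) //.
by apply: eq_from_tnth => i; rewrite tnth_mktuple uo.
Qed.

(** Cylinder events of the past, which serve as the pi-system. *)
Definition window_determined (A : set T) : Prop :=
  exists n, forall o o', window n o = window n o' -> A o -> A o'.

(** Lengthening windows lets two events share one and brings its length to at least [m]. *)
Lemma window_determined_ge (A : set T) k : window_determined A ->
  exists2 n, (k <= n)%N & forall o o', window n o = window n o' -> A o -> A o'.
Proof.
move=> [n An]; exists (maxn n k) => [|o o' oo']; first exact: leq_maxr.
by apply: An; rewrite -!(drop_window _ (leq_maxl n k)) oo'.
Qed.

Lemma window_determinedI : setI_closed window_determined.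
Proof.
move=> A B detA [k Bk]; have [n kn An] := window_determined_ge k detA.
exists n => o o' oo' [Ao Bo]; split; first exact: An Ao.
by apply: Bk Bo; rewrite -!(drop_window _ kn) oo'.
Qed.

Lemma window_determined_measurable : window_determined `<=` measurable.
Proof.
move=> A [n An].
rewrite (_ : A = window n @^-1` [set w | exists2 o, A o & window n o = w]).
  exact: measurable_symbols_after law _ _ _.
apply/seteqP; split=> [ o Ao|o [ o' Ao' oo']]; first by exists o.
exact: An Ao'.
Qed.

Lemma past_window_determined : past x_ `<=` <<s window_determined >>.
Proof.
apply: smallest_sub; first exact: smallest_sigma_algebra.
move=> _ [t [x [t0 ->]]]; apply: sub_sigma_algebra.
(* Since [t <= 0], a window of length $|t|+1$ starts at time [t], so its entry 0 is the letter at
   time [t]. *)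
exists `|t|%N.+1 => o o' oo' /=.
have := congr1 (nth true ^~ 0%N) oo'; rewrite !nth_mkseq //.
by rewrite (_ : - _ + _ = t) => [->|]; last by lia.
Qed.

(** The two events fix the words [rcons w x] and [w], whose probabilities do not depend on the
    starting time; [word_prob_cat_long] relates them. *)
Lemma window_next_prob u n (w : seq bool) x : (m <= n)%N -> size w = n ->
  P (window n @^-1` [set w] `&` x_ 1 @^-1` [set x]) =
  ((emit G (run u w) x)%:E * P (window n @^-1` [set w]))%E.
Proof.
move=> mn wn; subst n; rewrite (symbols_after_prob law true) -EFinM.
rewrite -state_word_prob_letter // mulrC -word_prob_cat_long // cats1.
rewrite -(symbols_after_prob law true (- (size w)%:Z)); congr (P _).
rewrite size_rcons; apply/seteqP; split=> o /=; rewrite /symbols_after mkseqS.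
  by move=> [-> xo]; rewrite (_ : - _ + _ = 1 :> int) ?xo //; lia.
move=> /rcons_inj [-> <-]; split=> //; congr (x_ _ o); lia.
Qed.

(** For fixed [u] and [x] both sides are finite measures in [A], so agreement on window-determined
    events suffices; there [window_next_prob] is summed over windows. *)
Lemma past_next_prob u x (A : set T) : past x_ A ->
  P (A `&` last_symbols x_ m @^-1` [set u] `&` x_ 1 @^-1` [set x]) =
  ((emit G u x)%:E * P (A `&` last_symbols x_ m @^-1` [set u]))%E.
Proof.
move=> /past_window_determined.
have mx t y : measurable (x_ t @^-1` [set y]) by case: law => mx _ _.
have mL : measurable (last_symbols x_ m @^-1` [set u]).
  exact: measurable_last_symbols.
have mLx := measurableI _ _ mL (mx 1 x).
have e0 : 0 <= emit G u x by exact/ltW/emit_gt0.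
pose m1 := mrestr P mLx.
pose m2 := mscale (NngNum e0) (mrestr P mL).
rewrite -setIA -[LHS]/(m1 A) -[RHS]/(m2 A).
apply: (@g_sigma_algebra_measure_unique _ _ _
  window_determined _ (fun=> setT)) => //.
- exact: window_determined_measurable.
- by move=> _; exists 0%N.
- by apply/seteqP; split=> // o _; exists 0%N.
- exact: window_determinedI.
- move=> B dB; have mB := window_determined_measurable dB.
  have [n mn Bn] := window_determined_ge m dB.
  have mZ w : measurable (last_symbols x_ n @^-1` [set w]).
    exact: measurable_last_symbols.
  rewrite -[LHS]/(P (B `&` (_ `&` _))) -[RHS]/(_ * P (B `&` _))%E setIA.
  set C := B `&` last_symbols x_ m @^-1` [set u].
  have mC : measurable C by exact: measurableI.
  rewrite (measure_partition mZ P (measurableI _ _ mC (mx 1 x))).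
  rewrite (measure_partition mZ P mC) ge0_sume_distrr //.
  apply: eq_bigr => w _; rewrite setIAC.
  have Zw : last_symbols x_ n @^-1` [set w] = window n @^-1` [set tval w].
    apply/seteqP; split=> o /=; rewrite -tval_last_symbols; first by move->.
    exact: val_inj.
  (* Since [C] is determined by the window, the cylinder of [w] either lies inside [C] or misses
     it. *)
  have [[ o [[Bo uo] /= ow]]|Cw] := pselect (exists o, C o /\ window n o = w).
    have uw : run u w = u by rewrite -ow -last_symbols_run.
    rewrite (_ : C `&` _ = last_symbols x_ n @^-1` [set w]).
      by rewrite Zw (window_next_prob u) ?size_tuple // uw.
    rewrite Zw; apply/seteqP; split=> [ z []|o' o'w] //; split=> //; split.
      by apply: Bn Bo; rewrite ow.
    by rewrite /= (last_symbols_run u o' mn) (o'w : window n o' = w).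
  rewrite (_ : C `&` _ = set0) ?set0I ?measure0 ?mule0 //.
  by rewrite Zw -subset0 => o [Co ow]; apply: Cw; exists o.
- move=> _; rewrite /m1 /= /mrestr setTI.
  by rewrite (le_lt_trans (probability_le1 _ _)) ?ltry.
Qed.

Lemma next_depends_on_last_m : next_depends_on_last P x_ m.
Proof.
exists (fun x o => emit G (last_symbols x_ m o) x), (emit G) => x.
have mx t y : measurable (x_ t @^-1` [set y]) by case: law => mx _ _.
have mZ w : measurable (last_symbols x_ m @^-1` [set w]).
  exact: measurable_last_symbols.
have mf : measurable_fun setT (fun o => emit G (last_symbols x_ m o) x).
  move=> _ B _; rewrite setTI.
  exact: (measurable_last_symbols [set u | B (emit G u x)]).
split; last by apply: filterS (filterT) => o.
split.
- by move=> B _; exact: (past_last_symbols [set u | B (emit G u x)]).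
- apply: measurable_bounded_integrable => //.
    by rewrite (le_lt_trans (probability_le1 _ _)) ?ltry.
  exists 1; split; first exact: real1.
  move=> M M1 o _ /=; apply: ltW; apply: le_lt_trans M1.
  rewrite ger0_norm; last exact/ltW/emit_gt0.
  by case/andP: (p01 (last_symbols x_ m o)) => p0 p1; case: x {mf} => /=;
    rewrite ?gerBl ltW.
- move=> A pA; have mA := past_measurable pA.
  (* On each cell of the last [m] letters the integrand is constant, and [past_next_prob] evaluates
     the other side. *)
  rewrite (integral_partition mZ) //; last 2 first.
  + by apply/measurable_EFinP; exact: measurable_funS mf.
  + by move=> o; rewrite lee_fin ltW // emit_gt0.
  rewrite (measure_partition mZ P (measurableI _ _ mA (mx 1 x))).
  apply: eq_bigr => u _; rewrite setIAC.
  apply: etrans (esym (past_next_prob u x pA)); rewrite -integral_cst.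
    by apply: eq_integral => o; rewrite inE => -[_ /= ->].
  exact: measurableI.
Qed.

(** For [k < m] all contexts [run u w] end in the same [k] letters [w], so the single value
    [g w true] would have to equal [p (run u w)] for every [u]. *)
Lemma next_depends_on_last_ge k :
  injective p -> next_depends_on_last P x_ k -> (m <= k)%N.
Proof.
move=> p_inj [f [g fg]]; rewrite leqNgt; apply/negP => km.
have [[_ f_int fE] fg_ae] := fg true.
pose w := [tuple of nseq k true].
have gp u : g w true = p (run u w).
  set v := run u w.
  have pL : past x_ (last_symbols x_ m @^-1` [set v]).
    exact: past_last_symbols.
  have mL := past_measurable pL.
  have Lw o : last_symbols x_ m o = v -> last_symbols x_ k o = w.
    move=> ov; apply: val_inj; rewrite [LHS]tval_last_symbols.
    rewrite -(drop_window o (ltnW km)) -tval_last_symbols ov run_drop //.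
    rewrite drop_drop size_tuple subnK ?(ltnW km) //.
    by rewrite drop_size_cat // size_tuple.
  have PL : P (last_symbols x_ m @^-1` [set v]) = (word_prob G v)%:E.
    rewrite -(symbols_after_prob law true (- m%:Z)) size_tuple; congr (P _).
    apply/seteqP; split=> o /=; rewrite -tval_last_symbols; first by move->.
    exact: val_inj.
  have := fE _ pL.
  have := past_next_prob v true pL; rewrite setIid PL => ->.
  (* On this event [f true] is almost everywhere the constant [g w true]; cancelling the positive
     probability of [v] identifies it. *)
  rewrite (@ae_eq_integral _ _ _ _ _ (cst (g w true)%:E)) //.
  - rewrite integral_cst // [X in (_ * X)%E]PL -!EFinM => -[] /mulIf; apply.
    by rewrite gt_eqF // word_prob_gt0.
  - by case/integrableP: f_int => + _; exact: measurable_funS.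
  - by apply: filterS fg_ae => o /= -> /Lw ->.
have := run_short_neq m_gt0 (w := w); rewrite size_tuple => /(_ km).
by apply/negP/negPn/eqP/p_inj; rewrite -!gp.
Qed.

Lemma binary_context_markov_order :
  injective p -> markov_order P x_ = m%:R%:E.
Proof.
move=> p_inj; apply: nat_inf_min; first exact: next_depends_on_last_m.
by move=> k; exact: next_depends_on_last_ge.
Qed.

End MarkovOrder.

Theorem proposition6p1 (R : realType) (m : nat) (hm : (1 <= m)%N)
    (p : m.-tuple bool -> R) (p01 : forall u, 0 < p u < 1)
    (p_inj : injective p) :
  exists q : m.-tuple bool -> R,
    let G := binary_context p q in
    is_epsilon_machine G /\
    exact_generator G /\
    #|{: m.-tuple bool}| = (2 ^ m)%N /\
    L_tar G = m%:R%:E /\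
    L_sep G = 1%:E /\
    L_syn G = m%:R%:E /\
    (forall (d : measure_display) (T : measurableType d)
       (P : probability T R) (x_ : int -> T -> bool),
       generated_by P x_ G -> markov_order P x_ = m%:R%:E) /\
    infinite_rank (hankel G) = (2 ^ m)%:R%:E.
Proof.
pose s0 := [tuple of nseq m true].
(* The transition matrix depends only on [emit] and [succ], so [p] stands in for the stationary law
   until [q] is constructed. *)
have T1 s : \sum_s' transition_matrix (binary_context p p) s s' = 1.
  by apply: transition_matrix_row_sum => //; exact: emit_sum1.
have [q [q_gt0 q1 fq uq]] :=
  primitive_stationary T1 (binary_context_primitive p hm p01) s0.
exists q; split; first exact: (binary_context_is_epsilon_machine hm p01 q_gt0).
split.
  by exists s0, (run s0 s0); apply: synchronizes_long; rewrite ?size_tuple.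
split; first by rewrite card_tuple card_bool.
split; first exact: binary_context_L_tar.
split; first exact: binary_context_L_sep.
split; first exact: binary_context_L_syn.
split; last exact: hankel_rank.
by move=> d T P x_ [s_ law]; exact: binary_context_markov_order law p_inj.
Qed.
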